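(* For each $m \in \{259, 304, 308, 372, 394, 483, 497\}$ there is no positive integer $n$ with $p^2(n,5) = m$; that is, no positive integer can be expressed as the sum of exactly $5$ positive squares in exactly $m$ ways.
   Context: $p^2(n,j)$ denotes the number of ways to write $n$ as a sum of exactly $j$ positive squares, up to order of summands. *)

(* Defs.v *)
From mathcomp Require Import all_boot.
Set Implicit Arguments.
Unset Strict Implicit.
Unset Printing Implicit Defensive.

(* A multiset of j positive squares with sum n is encoded by its square roots
   x_1 <= ... <= x_j, listed in nondecreasing order. The bound x_i <= n built
   into the type is harmless, since x_i <= x_i ^ 2 <= n. *)
Definition square_partitions (n j : nat) : {set j.-tuple 'I_n.+1} :=
  [set t : j.-tuple 'I_n.+1 |
    [&& sorted leq (map val t),
        all (fun x : 'I_n.+1 => 0 < x) t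
      & \sum_(x <- t) x ^ 2 == n]].

Definition p2 (n j : nat) : nat := #|square_partitions n j|.

(* Main.v *)
Require Import Defs.
From Stdlib Require Import ZArith NArith Nnat Lia.
From mathcomp Require Import all_boot zify.
Set Implicit Arguments.
Unset Strict Implicit.
Unset Printing Implicit Defensive.

(* For n <= 26000 the values p^2(n, 5) are computed. Larger n have more than 497
   partitions.

   Up to 4 * 10^10: subtracting from n the squares of some of the largest a with
   a ^ 2 <= n leaves numbers in a window [lo, hi], whose partitions into 4 squares
   are bounded below by computation, or by subtracting one further square and
   computing partitions into 3 squares. The parity of a keeps the remainders in
   residue classes mod 8 with many partitions.

   Beyond: a is taken in two opposite classes mod 80, all multiples of 5, such that
   n - a ^ 2 lies in a class mod 32 where Lagrange's four squares have at most one
   zero. If one is zero, replace a ^ 2 = (5 k) ^ 2 by (3 k) ^ 2 + (4 k) ^ 2. This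
   gives at least sqrt(n) / 40 choices of a, each partition arising at most 10
   times. *)

(** * Lagrange's four-square theorem *)

Definition sum4Z (n : Z) : Prop :=
  exists a b c d : Z, n = (a * a + b * b + c * c + d * d)%Z.

(** Euler's four-square identity. *)
Lemma sum4Z_mul (m n : Z) : sum4Z m -> sum4Z n -> sum4Z (m * n)%Z.
Proof.
move=> [a [b [c [d ->]]]] [a' [b' [c' [d' ->]]]].
exists (a * a' + b * b' + c * c' + d * d')%Z, (a * b' - b * a' + c * d' - d * c')%Z,
  (a * c' - c * a' + d * b' - b * d')%Z, (a * d' - d * a' + b * c' - c * b')%Z.
ring.
Qed.

Lemma centered_residue (m x : Z) : (0 < m)%Z ->
  exists y k : Z, x = (y + m * k)%Z /\ (- m <= 2 * y <= m)%Z.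
Proof.
move=> m_gt0; have dx := Z.div_mod x m ltac:(lia).
have bx := Z.mod_pos_bound x m m_gt0.
case: (Z_le_gt_dec (2 * (x mod m)) m) => h.
  by exists (x mod m)%Z, (x / m)%Z; lia.
by exists (x mod m - m)%Z, (x / m + 1)%Z; lia.
Qed.

(** Lagrange's descent. Replacing the roots by residues [y_i] with [2 * |y_i| <= m] gives a sum of
    squares [m * r] with [r <= m]. Euler's identity for [(m * p) * (m * r)] has all four roots
    divisible by [m]. The extremes [r = 0] and [r = m] would force [m | p]. *)
Lemma sum4Z_descent (m p : Z) : (1 < m)%Z -> ~ (m | p)%Z -> sum4Z (m * p) ->
  exists r : Z, (0 < r < m)%Z /\ sum4Z (r * p).
Proof.
move=> m_gt1 ndvd [x1 [x2 [x3 [x4 e]]]].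
have m_gt0 : (0 < m)%Z by lia.
case: (centered_residue x1 m_gt0) => y1 [k1 [e1 b1]].
case: (centered_residue x2 m_gt0) => y2 [k2 [e2 b2]].
case: (centered_residue x3 m_gt0) => y3 [k3 [e3 b3]].
case: (centered_residue x4 m_gt0) => y4 [k4 [e4 b4]].
pose s := (y1 * k1 + y2 * k2 + y3 * k3 + y4 * k4)%Z.
pose q := (k1 * k1 + k2 * k2 + k3 * k3 + k4 * k4)%Z.
pose r := (p - 2 * s - m * q)%Z.
have er : (y1 * y1 + y2 * y2 + y3 * y3 + y4 * y4 = m * r)%Z.
  have -> : (m * r = m * p - 2 * m * s - m * m * q)%Z by rewrite /r; ring.
  by rewrite e e1 e2 e3 e4 /s /q; ring.
have sq (y : Z) : (- m <= 2 * y <= m)%Z -> (0 <= y * y /\ 4 * (y * y) <= m * m)%Z by nia.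
have [p1 q1] := sq _ b1; have [p2 q2] := sq _ b2.
have [p3 q3] := sq _ b3; have [p4 q4] := sq _ b4.
have r_ge0 : (0 <= r)%Z by apply/(Z.mul_le_mono_pos_l _ _ m m_gt0); lia.
have r_lem : (r <= m)%Z by apply/(Z.mul_le_mono_pos_l _ _ m m_gt0); lia.
have r_neq0 : (r <> 0)%Z.
  move=> r0; rewrite r0 Z.mul_0_r in er; apply: ndvd; exists q.
  have sq0 (y : Z) : (y * y = 0 -> y = 0)%Z by case/Z.mul_eq_0.
  have [z1 [z2 [z3 z4]]] : (y1 = 0 /\ y2 = 0 /\ y3 = 0 /\ y4 = 0)%Z.
    by do !split; apply: sq0; lia.
  by move: r0; rewrite /r /s z1 z2 z3 z4; lia.
(* If [r = m], every bound is attained: [2 * y_i] is [m] or [- m], so [m] divides [2 * s] and hence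
   [p]. *)
have r_neqm : (r <> m)%Z.
  move=> rm; rewrite rm in er; apply: ndvd.
  have half (y k : Z) : (4 * (y * y) = m * m)%Z -> (m | 2 * (y * k))%Z.
    move=> h; have [h'|h'] : (2 * y = m \/ 2 * y = - m)%Z.
      have /Z.mul_eq_0[] : ((2 * y - m) * (2 * y + m) = 0)%Z by lia.
        by left; lia.
      by right; lia.
      by exists k; rewrite -h'; ring.
    by exists (- k)%Z; have -> : m = (- (2 * y))%Z by [lia|ring]; ring.
  have [z1 [z2 [z3 z4]]] : (4 * (y1 * y1) = m * m /\ 4 * (y2 * y2) = m * m /\
     4 * (y3 * y3) = m * m /\ 4 * (y4 * y4) = m * m)%Z by lia.
  have [u1 h1] := half _ k1 z1; have [u2 h2] := half _ k2 z2.
  have [u3 h3] := half _ k3 z3; have [u4 h4] := half _ k4 z4.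
  exists (1 + u1 + u2 + u3 + u4 + q)%Z.
  have -> : (p = r + 2 * s + m * q)%Z by rewrite /r; ring.
  have -> : (2 * s = (u1 + u2 + u3 + u4) * m)%Z by rewrite /s; lia.
  by rewrite rm; ring.
exists r; split; first by lia.
(* The roots of Euler's identity for the [x_i] and [y_i], divided by [m], with
   [x_i = y_i + m * k_i]. *)
exists (r + s)%Z, (k1 * y2 - k2 * y1 + k3 * y4 - k4 * y3)%Z,
  (k1 * y3 - k3 * y1 + k4 * y2 - k2 * y4)%Z, (k1 * y4 - k4 * y1 + k2 * y3 - k3 * y2)%Z.
apply: (Z.mul_reg_l _ _ (m * m)%Z); first by nia.
have -> : (m * m * (r * p) = (m * p) * (m * r))%Z by ring.
rewrite e e1 e2 e3 e4.
set z1 := (r + s)%Z.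
transitivity ((m * r + m * s) * (m * r + m * s)
   + m * m * ((k1 * y2 - k2 * y1 + k3 * y4 - k4 * y3) * (k1 * y2 - k2 * y1 + k3 * y4 - k4 * y3)
   + (k1 * y3 - k3 * y1 + k4 * y2 - k2 * y4) * (k1 * y3 - k3 * y1 + k4 * y2 - k2 * y4)
   + (k1 * y4 - k4 * y1 + k2 * y3 - k3 * y2) * (k1 * y4 - k4 * y1 + k2 * y3 - k3 * y2)))%Z; last by rewrite /z1; ring.
by rewrite -er /s; ring.
Qed.

Lemma sqr_inj_mod (p x y : nat) : prime p -> x <= y -> (x + y) < p ->
  p %| y ^ 2 - x ^ 2 -> x = y.
Proof.
move=> p_pr le_xy lt_p; rewrite subn_sqr Euclid_dvdM // => /orP[] /dvdnP[] [|k] e; nia.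
Qed.

(** Pigeonhole: [x ^ 2] and [- 1 - y ^ 2] each take [(p + 1) / 2] distinct values mod [p], so they
    share one. Adding [p ^ 2] keeps the second a natural number. *)
Lemma prime_dvd_sqrD1 (p : nat) : prime p -> odd p ->
  exists x y : nat, [/\ x <= p./2, y <= p./2 & p %| x ^ 2 + y ^ 2 + 1].
Proof.
move=> p_pr p_odd; have p_gt0 := prime_gt0 p_pr.
set h := p./2; have ep : p = h.*2.+1 by rewrite /h; lia.
pose f (x : 'I_h.+1) : 'I_p := Ordinal (ltn_pmod (x ^ 2) p_gt0).
pose g (x : 'I_h.+1) : 'I_p := Ordinal (ltn_pmod (p ^ 2 - 1 - x ^ 2) p_gt0).
have le_h (x : 'I_h.+1) : x <= h by rewrite -ltnS.
have le_p2 (x : 'I_h.+1) : x ^ 2 < p ^ 2 by rewrite ltn_exp2r // ep; have := le_h x; lia.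
have f_inj : injective f.
  suff H (x y : 'I_h.+1) : x <= y -> f x = f y -> x = y.
    by move=> x y e; case: (leqP x y) => [|/ltnW] le; [|symmetry]; apply: H.
  move=> le [/esym/eqP]; rewrite eqn_mod_dvd ?leq_exp2r // => d; apply: val_inj.
  by apply: (sqr_inj_mod p_pr le) => //; have := le_h x; have := le_h y; lia.
have g_inj : injective g.
  suff H (x y : 'I_h.+1) : x <= y -> g x = g y -> x = y.
    by move=> x y e; case: (leqP x y) => [|/ltnW] le; [|symmetry]; apply: H.
  move=> le [/eqP]; have le2 : x ^ 2 <= y ^ 2 by rewrite leq_exp2r.
  have := le_p2 y => lt2; rewrite eqn_mod_dvd; last by lia.
  have -> : p ^ 2 - 1 - x ^ 2 - (p ^ 2 - 1 - y ^ 2) = y ^ 2 - x ^ 2 by lia.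
  move=> d; apply: val_inj.
  by apply: (sqr_inj_mod p_pr le) => //; have := le_h x; have := le_h y; lia.
have : ~~ [disjoint f @: 'I_h.+1 & g @: 'I_h.+1].
  rewrite -setI_eq0; apply/negP => /eqP dis.
  have := cardsUI (f @: 'I_h.+1) (g @: 'I_h.+1).
  have : #|f @: 'I_h.+1 :|: g @: 'I_h.+1| <= p by rewrite -[leqRHS]card_ord max_card.
  rewrite dis cards0 !card_imset // card_ord; lia.
case/pred0Pn => z /= /andP[/imsetP[x _ ->] /imsetP[y _ [/eqP e]]].
exists x, y; split=> //.
have lt2 := le_p2 y.
have : x ^ 2 + (y ^ 2 + 1) == p ^ 2 - 1 - y ^ 2 + (y ^ 2 + 1) %[mod p] by rewrite eqn_modDr.
have -> : p ^ 2 - 1 - y ^ 2 + (y ^ 2 + 1) = p ^ 2 by lia.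
by rewrite addnA /dvdn => /eqP ->; rewrite -mulnn modnMl.
Qed.

Lemma sum4Z_prime (p : nat) : prime p -> sum4Z (Z.of_nat p).
Proof.
move=> p_pr; have p_gt1 := prime_gt1 p_pr.
have [p_odd|p_even] := boolP (odd p); last first.
  have -> : p = 2 by case: (even_prime p_pr) p_even => // ->.
  by exists 1%Z, 1%Z, 0%Z, 0%Z.
have descend (m : nat) : 0 < m -> m < p -> sum4Z (Z.of_nat m * Z.of_nat p) -> sum4Z (Z.of_nat p).
  elim/ltn_ind: m => m IH m_gt0 m_ltp hm.
  have [m1|m_neq1] := eqVneq m 1; first by move: hm; rewrite m1 Z.mul_1_l.
  have ndvd : ~ (Z.of_nat m | Z.of_nat p)%Z.
    move=> [k ek]; case/primeP: p_pr => _ pd.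
    have /pd : m %| p by apply/dvdnP; exists (Z.to_nat k); nia.
    by case/orP => /eqP; lia.
  have m_gt1 : (1 < Z.of_nat m)%Z by lia.
  have [r [hr sr]] := sum4Z_descent m_gt1 ndvd hm.
  by apply: (IH (Z.to_nat r)); rewrite ?Z2Nat.id //; lia.
have [x [y [hx hy /dvdnP[m em]]]] := prime_dvd_sqrD1 p_pr p_odd.
have ep : p = p./2.*2.+1 by lia.
apply: (descend m); [nia|nia|].
exists (Z.of_nat x), (Z.of_nat y), 1%Z, 0%Z; nia.
Qed.

Theorem sum_four_squares (n : nat) :
  exists a b c d : nat, n = a ^ 2 + b ^ 2 + c ^ 2 + d ^ 2.
Proof.
suff : sum4Z (Z.of_nat n).
  have sqZ (z : Z) : Z.of_nat (Z.abs_nat z ^ 2) = (z * z)%Z by nia.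
  case=> a [b [c [d e]]].
  exists (Z.abs_nat a), (Z.abs_nat b), (Z.abs_nat c), (Z.abs_nat d).
  by rewrite -!sqZ in e; lia.
elim/ltn_ind: n => n IH.
have [n_le1|n_gt1] := leqP n 1.
  by exists (Z.of_nat n), 0%Z, 0%Z, 0%Z; case: n n_le1 {IH} => [|[|]].
have [k ek] := dvdnP (pdiv_dvd n).
have := prime_gt1 (pdiv_prime n_gt1) => p_gt1.
rewrite {1}ek (_ : Z.of_nat _ = Z.of_nat k * Z.of_nat (pdiv n))%Z; last by lia.
by apply: sum4Z_mul; [apply: IH; nia | exact/sum4Z_prime/pdiv_prime].
Qed.

(** * Enumerating partitions into squares *)

(* The partitions of n into j squares, as nonincreasing lists of roots in [1, s]. *)
Fixpoint reps (j s n : nat) : seq (seq nat) :=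
  if j is j'.+1 then
    flatten [seq [seq a :: t | t <- reps j' a (n - a ^ 2)] | a <- iota 1 s & a ^ 2 <= n]
  else if n == 0 then [:: [::]] else [::].

Lemma mem_reps (j s n : nat) (t : seq nat) :
  (t \in reps j s n) =
  [&& size t == j, path geq s t, all (leq 1) t & sumn [seq x ^ 2 | x <- t] == n].
Proof.
elim: j s n t => [|j IH] s n t /=.
  by case: n => [|n]; case: t => [|x t].
apply/flatten_mapP/idP => [[a]|].
  rewrite mem_filter mem_iota => /andP[an /andP[a0 as_]] /mapP[u].
  rewrite IH => /and4P[/eqP su pu au /eqP eu] -> /=.
  by rewrite su eqxx pu au a0 eu /=; lia.
case: t => // a t /=; rewrite eqSS => /and4P[st /andP[sa pt] /andP[a0 at_] /eqP et].
exists a; first by rewrite mem_filter mem_iota -et leq_addr /=; lia.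
by rewrite map_f // IH st pt at_ -et addKn eqxx.
Qed.

Lemma uniq_reps (j s n : nat) : uniq (reps j s n).
Proof.
elim: j s n => [|j IH] s n /=; first by case: eqP.
apply: allpairs_uniq_dep; first by rewrite filter_uniq ?iota_uniq.
  by move=> a _; apply: IH.
by move=> [a t] [b u] _ _ /= [-> ->].
Qed.

(** The second term counts the lists with largest root [s.+1]. The tables are built on this
    recurrence. *)
Lemma size_reps_recr (j s n : nat) :
  size (reps j.+1 s.+1 n) = size (reps j.+1 s n) +
    (if s.+1 ^ 2 <= n then size (reps j s.+1 (n - s.+1 ^ 2)) else 0).
Proof.
have unf u : reps j.+1 u n =
  flatten [seq [seq a :: t | t <- reps j a (n - a ^ 2)] | a <- iota 1 u & a ^ 2 <= n] by [].
have e : iota 1 s.+1 = iota 1 s ++ [:: s.+1] by rewrite -[in LHS](addn1 s) iotaD add1n.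
rewrite !unf e filter_cat map_cat flatten_cat size_cat.
congr (_ + _); rewrite [filter _ _]/=.
by case: ifP => _ //=; rewrite cats0 size_map.
Qed.

Lemma path_geq_all (s : nat) (t : seq nat) : path geq s t -> all (geq s) t.
Proof. by move=> /(order_path_min (fun y x z h1 h2 => leq_trans h2 h1)). Qed.

Lemma reps_le_sumsq (j s n : nat) (t : seq nat) :
  t \in reps j s n -> all (fun x => x ^ 2 <= n) t.
Proof.
rewrite mem_reps => /and4P[_ _ _ /eqP <-].
elim: t => //= x t IH; rewrite leq_addr /=.
by apply: sub_all IH => y le_y; apply: leq_trans le_y (leq_addl _ _).
Qed.

Lemma reps_bound (j s s' n : nat) : n < s.+1 ^ 2 -> n < s'.+1 ^ 2 ->
  size (reps j s n) = size (reps j s' n).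
Proof.
suff sub u v : n < v.+1 ^ 2 -> {subset reps j u n <= reps j v n}.
  by move=> hs hs'; apply/eqP; rewrite eqn_leq !uniq_leq_size ?uniq_reps //; apply: sub.
move=> hv t tu; have := reps_le_sumsq tu; move: tu; rewrite !mem_reps.
case/and4P => -> pt -> -> /=; rewrite !andbT.
case: t pt => //= x t /andP[_ ->] /andP[le_x _]; rewrite andbT.
by rewrite -ltnS -(ltn_exp2r _ _ (isT : 0 < 2)); apply: leq_ltn_trans hv.
Qed.

(** Reversal turns nondecreasing tuples into nonincreasing lists; by [reps_bound], any cap [s] that
    admits all roots up to the square root of [n] gives the same count. *)
Lemma p2E (j s n : nat) : n < s.+1 ^ 2 -> p2 n j = size (reps j s n).
Proof.
move=> hs; rewrite (@reps_bound j s n) //; last by nia.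
rewrite /p2 cardE -(size_map (fun t : j.-tuple 'I_n.+1 => rev (map val t))).
apply/perm_size/uniq_perm; rewrite ?uniq_reps //.
  rewrite map_inj_uniq ?enum_uniq // => t u /(can_inj revK).
  by move=> /(inj_map val_inj)/val_inj.
move=> t; rewrite mem_reps; apply/mapP/and4P => [[u]|[/eqP st pt at_ /eqP et]].
  rewrite mem_enum inE => /and3P[su au /eqP eu] ->.
  rewrite size_rev size_map size_tuple; split=> //.
  - rewrite path_min_sorted ?rev_sorted //; last by rewrite all_rev all_map; apply/allP => x _ /=; rewrite -ltnS.
  - by rewrite all_rev all_map.
  - by rewrite map_rev sumn_rev -map_comp sumnE big_map eu.
have lt : all (fun x => x < n.+1) t by have := path_geq_all pt.
pose u := [seq inord x : 'I_n.+1 | x <- rev t].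
have su : size u == j by rewrite size_map size_rev st.
have eu : [seq val i | i <- u] = rev t.
  rewrite -map_comp -[RHS]map_id; apply/eq_in_map => x.
  by rewrite mem_rev => xt /=; rewrite inordK // (allP lt).
exists (Tuple su); last by rewrite /= eu revK.
rewrite mem_enum inE /= eu rev_sorted (path_sorted pt).
have -> : all (fun x : 'I_n.+1 => 0 < x) u by rewrite -(all_map val) eu all_rev.
have -> : \sum_(x <- u) x ^ 2 = sumn [seq x ^ 2 | x <- [seq val i | i <- u]].
  by rewrite sumnE !big_map.
by rewrite eu map_rev sumn_rev et eqxx.
Qed.

(** * Lower bounds from subtracting large squares *)

Lemma reps_mono (j s s' n : nat) : s <= s' -> size (reps j.+1 s n) <= size (reps j.+1 s' n).
Proof.
move=> /subnK <-; elim: (s' - s) => [|k IH] //.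
by rewrite addSn size_reps_recr (leq_trans IH) // leq_addr.
Qed.

(** Lists with different heads [s - 2 * i] are distinct, so their counts add up. *)
Lemma size_reps_ge (j I c s n : nat) :
  (forall i, i < I -> [/\ 2 * i < s, (s - 2 * i) ^ 2 <= n
    & c <= size (reps j (s - 2 * i) (n - (s - 2 * i) ^ 2))]) ->
  I * c <= size (reps j.+1 s n).
Proof.
elim: I s => [|I IH] s H; first by rewrite mul0n.
have [s_gt0 sn cs] := H 0 isT; rewrite subn0 in sn cs.
case: s => [|s] in H s_gt0 sn cs *; first by [].
rewrite size_reps_recr sn mulSn addnC leq_add //.
have [I0|I_gt0] := posnP I; first by rewrite I0 mul0n.
case: s => [|s] in H s_gt0 sn cs *; first by case: (H 1 I_gt0).
apply: leq_trans (reps_mono _ _ (leqnSn s)); apply: IH => i ltiI.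
case: (H i.+1 ltiI) => h1 h2 h3.
have e : s.+2 - 2 * i.+1 = s - 2 * i by lia.
by rewrite e in h2 h3; split=> //; lia.
Qed.

Lemma sqrt_floor (n : nat) : exists s, s ^ 2 <= n < s.+1 ^ 2.
Proof.
elim: n => [|n [s /andP[h1 h2]]]; first by exists 0.
have [h|h] := leqP (s.+1 ^ 2) n.+1; first by exists s.+1; rewrite h /=; nia.
by exists s; rewrite h andbT; apply: leqW.
Qed.

Lemma ltn_succ_sqr (n : nat) : n < n.+1 ^ 2.
Proof. nia. Qed.

Lemma sqr_gap (v a I : nat) : a <= v <= a + 2 * I -> v ^ 2 <= a ^ 2 + 4 * I * v.
Proof.
case/andP => /subnKC <-; move: (v - a) => k; rewrite leq_add2l => le_kI.
have : 2 * k * (a + k) <= 4 * I * (a + k) by rewrite leq_mul2r; lia.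
lia.
Qed.

(* Subtracting the I largest squares a ^ 2 <= n - lo with a of prescribed parity;
   as n - a ^ 2 <= a ^ 2, the number a is the largest part, so the resulting
   partitions are distinct. *)
Lemma window (j I c lo S n : nat) (e : bool) :
  lo + (2 * I) ^ 2 <= n -> n < lo + S ^ 2 -> 2 * (lo + 4 * I * S) <= n ->
  (forall a x, odd a = e -> x + a ^ 2 = n -> lo <= x <= lo + 4 * I * S -> c <= p2 x j) ->
  I * c <= p2 n j.+1.
Proof.
move=> hI hS hn H; have [u /andP[u1 u2]] := sqrt_floor (n - lo).
have uS : u < S by rewrite -(ltn_exp2r _ _ (isT : 0 < 2)); lia.
have uI : 2 * I <= u by rewrite -ltnS -(ltn_exp2r _ _ (isT : 0 < 2)); lia.
(* The largest number of parity [e] up to [u]. *)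
pose s := u - (odd u != e).
have hs : s <= u <= s.+1 by rewrite /s; case: eqP => _ /=; lia.
have os : 0 < u -> odd s = e by rewrite /s; clear; case: e; lia.
have sn : s <= n.
  have : u <= u ^ 2 by case: (u) => // k; rewrite -mulnn leq_pmull.
  lia.
clearbody s; rewrite (p2E _ (ltn_succ_sqr n)).
apply: leq_trans (reps_mono _ _ sn); apply: size_reps_ge => i ltiI.
have [oa e1 le_ua le_au] : [/\ odd (s - 2 * i) = e, (2 * i < s) = (0 < s - 2 * i),
    u.+1 <= s - 2 * i + 2 * I & s - 2 * i <= u].
  by rewrite -os; [move: hs uI ltiI; clear; split; lia | lia].
rewrite {}e1; have : 0 < s - 2 * i by lia.
move: (s - 2 * i) oa le_ua le_au => a oa le_ua le_au a_gt0.
have a2 : a ^ 2 <= n - lo by apply: leq_trans u1; rewrite leq_exp2r.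
have hx : n < a ^ 2 + lo + 4 * I * S.
  have := @sqr_gap u.+1 a I; have : 4 * I * u.+1 <= 4 * I * S by rewrite leq_mul2l uS orbT.
  by move: u2 le_ua le_au; clear; lia.
have an : a ^ 2 <= n by move: a2; clear; lia.
split=> //; rewrite -p2E.
  by apply: (H a); rewrite ?subnK //; move: a2 hx a_gt0; clear; lia.
(* The remainder is below [a.+1 ^ 2], so the cap [a] on its roots excludes nothing. *)
have := leq_exp2r a a.+1 (isT : 0 < 2); rewrite leqnSn; move: hx hn; clear; lia.
Qed.

(** * Tables *)

(* The table below is also evaluated by call-by-need conversion, without the
   virtual machine. Forcing every row keeps unevaluated sums from piling up, and
   naming the type [row] keeps the type argument of [cons] a closed constant; a
   compound argument would retain all earlier rows. *)
Definition row := seq N.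

Fixpoint add_seq (l m : row) : row :=
  match l, m with
  | x :: l', y :: m' => N.add x y :: add_seq l' m'
  | _, _ => l
  end.

Fixpoint add_shift (d : nat) (l m : row) : row :=
  match d, l with
  | 0, _ => add_seq l m
  | d'.+1, x :: l' => x :: add_shift d' l' m
  | _.+1, [::] => [::]
  end.

(** The row handed on is the updated [l'], because the square [d] may be used repeatedly. *)
Fixpoint add_rows (d : nat) (prev : row) (rows : seq row) : seq row :=
  if rows is l :: rows' then
    let l' : row := add_shift d l prev in l' :: add_rows d l' rows'
  else [::].

Fixpoint force_pos (p : positive) : bool :=
  match p with xH => true | xO q => force_pos q | xI q => force_pos q end.

Definition force (rows : seq row) : bool :=
  all (all (fun x => if x is N.pos p then force_pos p else true)) rows.

(* Row j of [table T k s] lists, for n <= T, the number of ways to write n as a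
   sum of j + 1 squares of integers in [1, s]. *)
Fixpoint table (T k s : nat) : seq row :=
  if s is s'.+1 then
    let rows := add_rows (s'.+1 ^ 2) (1%num :: nseq T 0%num) (table T k s') in
    if force rows then rows else rows
  else nseq k (nseq T.+1 0%num : row).

Lemma size_add_shift (d : nat) (l m : row) : size (add_shift d l m) = size l.
Proof.
elim: d l => [|d IH] [|x l] //=; last by rewrite IH.
by case: m => //= y m; congr S; elim: l m => [|z l IH] [|t m] //=; rewrite IH.
Qed.

Lemma nth_add_shift (d : nat) (l m : row) (i : nat) : i < size l ->
  nth 0%num (add_shift d l m) i =
  (nth 0%num l i + (if (d <= i)%N then nth 0%num m (i - d)%N else 0))%num.
Proof.
elim: d l i => [|d IH] [|x l] // [|i] //= lti; last 2 first.
- by rewrite N.add_0_r.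
- by rewrite IH.
- by case: m => [|y m] //=; rewrite N.add_0_r.
case: m => [|y m] /=; first by rewrite N.add_0_r.
by elim: l m i lti => [|z l IH] [|t m] [|i] //= lti; rewrite ?N.add_0_r ?IH.
Qed.

Definition counts (T j s : nat) (l : row) : Prop :=
  size l = T.+1 /\ forall n, n <= T -> N.to_nat (nth 0%num l n) = size (reps j s n).

Lemma counts_add_shift (T j s : nat) (l prev : row) :
  counts T j.+1 s l -> counts T j s.+1 prev ->
  counts T j.+1 s.+1 (add_shift (s.+1 ^ 2) l prev).
Proof.
move=> [sl hl] [_ hp]; split; first by rewrite size_add_shift.
move=> n le_nT; rewrite nth_add_shift ?sl // size_reps_recr N2Nat.inj_add hl //.
by congr (_ + _); case: ifP => // _; rewrite hp //; lia.
Qed.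

Lemma counts_add_rows (T j s : nat) (prev : row) (rows : seq row) :
  counts T j s.+1 prev ->
  (forall i, i < size rows -> counts T (j + i).+1 s (nth [::] rows i)) ->
  forall i, i < size rows ->
    counts T (j + i).+1 s.+1 (nth [::] (add_rows (s.+1 ^ 2) prev rows) i).
Proof.
elim: rows j prev => [|l rows IH] // j prev hp H.
have hl : counts T j.+1 s.+1 (add_shift (s.+1 ^ 2) l prev).
  by apply: counts_add_shift hp; have := H 0 isT; rewrite addn0.
case=> [|i] lti; first by rewrite addn0.
rewrite -addSnnS; apply: (IH j.+1 _ hl) => // i' lti'.
by rewrite addSnnS; apply: (H i'.+1).
Qed.

Lemma size_add_rows (d : nat) (prev : row) (rows : seq row) :
  size (add_rows d prev rows) = size rows.
Proof. by elim: rows prev => //= l rows IH prev; rewrite IH. Qed.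

Lemma size_table (T k s : nat) : size (table T k s) = k.
Proof. by elim: s => [|s IH] /=; rewrite ?size_nseq // if_same size_add_rows. Qed.

Lemma counts_table (T k s j : nat) : j < k -> counts T j.+1 s (nth [::] (table T k s) j).
Proof.
elim: s j => [|s IH] j ltjk.
  rewrite /= nth_nseq ltjk; split; first by rewrite /= size_nseq.
  by move=> n le_nT; rewrite -[_ :: _]/(nseq T.+1 0%num) nth_nseq if_same.
rewrite [table _ _ _]/= if_same; apply: (@counts_add_rows T 0); last by rewrite size_table.
  split; first by rewrite /= size_nseq.
  by case=> [|n] //= _; rewrite nth_nseq if_same.
by rewrite size_table => i; apply: IH.
Qed.

Fixpoint all_from (P : N -> N -> bool) (i : N) (l : row) : bool :=
  if l is x :: l' then P i x && all_from P (N.succ i) l' else true.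

Lemma all_fromP (P : N -> N -> bool) (i : N) (l : row) (k : nat) :
  all_from P i l -> k < size l -> P (i + N.of_nat k)%num (nth 0%num l k).
Proof.
elim: l i k => [|x l IH] // i [|k]; rewrite ?Nat2N.inj_succ => /andP[Px Pl] ltk.
  by rewrite N.add_0_r.
by rewrite -N.add_succ_comm; apply: IH.
Qed.

Lemma all_from_table (P : N -> N -> bool) (T k s j n : nat) :
  all_from P 0 (nth [::] (table T k s) j) -> j < k -> T < s.+1 ^ 2 -> n <= T ->
  P (N.of_nat n) (N.of_nat (p2 n j.+1)).
Proof.
move=> hP ltjk hT le_nT; have [st ht] := counts_table T s ltjk.
have := all_fromP hP; move=> /(_ n); rewrite st ltnS => /(_ le_nT).
by rewrite N.add_0_l (@p2E _ s) -?ht ?N2Nat.id //; apply: leq_ltn_trans hT.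
Qed.

(** * Values read off the tables *)

Definition avoids (_ x : N) : bool :=
  all (fun m => ~~ (x =? m)%num) [:: 259; 304; 308; 372; 394; 483; 497]%num.

(** Multiples of 8 are exempt: their four roots are all even, so dividing by 4 preserves the count,
    which can stay small. *)
Definition large4 (i x : N) : bool :=
  if (i mod 8 =? 0)%num then true else if (i <? 6500)%num then true else
  if (i <=? 13000)%num then (109 <=? x)%num else (208 <=? x)%num.

(** Numbers 7 mod 8 are not sums of three squares; for multiples of 4 all roots are even, so the
    count can stay small. *)
Definition large3 (i x : N) : bool :=
  if (i <? 6308)%num then true else
  if has (N.eqb (i mod 8)) [:: 0; 4; 7]%num then true else (5 <=? x)%num.

(** Roots up to 161 suffice, as [162 ^ 2 > 26000]. *)
Lemma table5_check :
  (let rows := table (N.to_nat 26000) 5 161 in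
   all_from large4 0 (nth [::] rows 3) && all_from avoids 0 (nth [::] rows 4)) = true.
Proof. by vm_cast_no_check (erefl true). Qed.

(** Roots up to 205 suffice, as [206 ^ 2 > 42104]. *)
Lemma table3_check :
  (all_from large3 0 (nth [::] (table (N.to_nat 42104) 3 205) 2)) = true.
Proof. by vm_cast_no_check (erefl true). Qed.

Lemma p2_5_avoids (n : nat) : n <= N.to_nat 26000 ->
  p2 n 5 \notin [:: 259; 304; 308; 372; 394; 483; 497].
Proof.
move=> hn; have /andP[_ h] := table5_check.
have := all_from_table h isT _ hn => /(_ ltac:(lia)).
rewrite /avoids /= !inE; move: (p2 n 5); clear; lia.
Qed.

Lemma N_of_nat_mod8 (n : nat) : (N.of_nat n mod 8)%num = N.of_nat (n %% 8).
Proof. by symmetry; apply: (N.mod_unique _ _ (N.of_nat (n %/ 8))); lia. Qed.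

Lemma p2_4_ge (n : nat) : n %% 8 != 0 -> N.to_nat 6500 <= n <= N.to_nat 26000 ->
  (if n <= N.to_nat 13000 then 109 else 208) <= p2 n 4.
Proof.
move=> n8 /andP[n_lo n_hi]; have /andP[h _] := table5_check.
have := all_from_table h isT _ n_hi => /(_ ltac:(lia)).
rewrite /large4 N_of_nat_mod8; move: n8 n_lo; move: (p2 n 4); clear => k n8 n_lo.
case: N.eqb_spec => [|_]; first by lia.
case: N.ltb_spec => [|_]; first by lia.
by case: N.leb_spec; case: ifP; lia.
Qed.

Lemma p2_3_ge (n : nat) : n %% 8 \in [:: 1; 2; 3; 5; 6] ->
  N.to_nat 6308 <= n <= N.to_nat 42104 -> 5 <= p2 n 3.
Proof.
move=> n8 /andP[n_lo n_hi].
have := all_from_table table3_check isT _ n_hi => /(_ ltac:(lia)).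
rewrite /large3 N_of_nat_mod8; move: n8 n_lo; move: (p2 n 3); clear => k n8 n_lo.
case: N.ltb_spec => [|_]; first by lia.
case: ifP => [|_]; last by lia.
move: n8; rewrite /= !inE; lia.
Qed.

(** * Integers from 26000 to 4 * 10^10 *)

Lemma sqr_mod8 (a : nat) : a ^ 2 %% 8 \in (if odd a then [:: 1] else [:: 0; 4]).
Proof.
have : (a %% 8) \in iota 0 8 by rewrite mem_iota ltn_mod.
have -> : odd a = odd (a %% 8) by lia.
rewrite -modnXm; move: (a %% 8) => b.
by rewrite !inE => /or4P[|||/or4P[|||/orP[|]]] /eqP ->.
Qed.

(** An odd [a] leaves a remainder not divisible by 8 unless [n] is 1 mod 8; in that case an even [a]
    does. *)
Lemma p2_step (j I c lo S n : nat) :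
  lo + (2 * I) ^ 2 <= n -> n < lo + S ^ 2 -> 2 * (lo + 4 * I * S) <= n ->
  (forall x, x %% 8 != 0 -> lo <= x <= lo + 4 * I * S -> c <= p2 x j) ->
  I * c <= p2 n j.+1.
Proof.
move=> h1 h2 h3 H; apply: (@window j I c lo S n (n %% 8 != 1)) => // a x oa ex hx.
apply: H hx; have := sqr_mod8 a; rewrite oa; move: ex; clear => <-.
by case: ifP; rewrite !inE; lia.
Qed.

Lemma p2_4_ge5 (n : nat) : n %% 8 != 0 -> N.to_nat 84300 <= n <= N.to_nat 80090000 ->
  5 <= p2 n 4.
Proof.
move=> n8 /andP[n_lo n_hi]; rewrite -[5]mul1n.
(* The window ends at [6308 + 4 * 8949 = 42104], the end of the table. An even [a] is used when [n]
   is 1 or 5 mod 8, which keeps the remainder in these classes. *)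
apply: (@window 3 1 5 (N.to_nat 6308) (N.to_nat 8949) n (n %% 8 \notin [:: 1; 5]));
  [lia|lia|lia|].
move=> a x oa ex hx; apply: p2_3_ge; last by lia.
have := sqr_mod8 a; rewrite oa; move: ex n8; clear => <-.
by case: ifP; rewrite !inE; lia.
Qed.

Lemma p2_5_large (n : nat) : N.to_nat 26000 <= n <= N.to_nat 40000000000 -> 498 <= p2 n 5.
Proof.
move=> /andP[n_lo n_hi].
have [n1|n1] := leqP n (N.to_nat 112000).
  apply: leq_trans (_ : 5 * 109 <= _); first by [].
  (* The window is [[6500, 13000]], where 109 is the tabulated bound. *)
  apply: (@p2_step 4 5 109 (N.to_nat 6500) (N.to_nat 325)); [lia|lia|lia|].
  by move=> x x8 hx; have := p2_4_ge x8; case: ifP; lia.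
have [n2|n2] := leqP n (N.to_nat 1185000).
  apply: leq_trans (_ : 3 * 208 <= _); first by [].
  (* The window is [[13001, 25997]], where 208 is the tabulated bound. *)
  apply: (@p2_step 4 3 208 (N.to_nat 13001) (N.to_nat 1083)); [lia|lia|lia|].
  by move=> x x8 hx; have := p2_4_ge x8; case: ifP; lia.
have [s /andP[s1 s2]] := sqrt_floor (n - N.to_nat 84300).
apply: leq_trans (_ : 100 * 5 <= _); first by [].
have s_hi : s < N.to_nat 200000 by nia.
(* [S] follows [n]: the window must stay below [n / 2] for small [n] and below 80090000 for large
   [n]. *)
apply: (@p2_step 4 100 5 (N.to_nat 84300) s.+1); [lia|lia|nia|].
by move=> x x8 hx; apply: p2_4_ge5 => //; lia.
Qed.

(** * Large integers *)

(** A sum of two squares is never 3 mod 4 or 6 mod 8, so at most one of Lagrange's four squares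
    vanishes. *)
Lemma three_nonzero_squares (m : nat) : (m %% 4 == 3) || (m %% 8 == 6) ->
  exists a b c d : nat, [/\ 0 < a, 0 < b, 0 < c & m = a ^ 2 + b ^ 2 + c ^ 2 + d ^ 2].
Proof.
move=> hm; have not2 u v : m <> u ^ 2 + v ^ 2.
  move=> e; have hu := sqr_mod8 u; have hv := sqr_mod8 v; move: hm hu hv.
  by rewrite e; clear; do 2!case: ifP => _; rewrite !inE; lia.
have [a [b [c [d e]]]] := sum_four_squares m.
case: (posnP a) => [a0|a_gt0]; last case: (posnP b) => [b0|b_gt0]; last first.
- case: (posnP c) => [c0|c_gt0]; last by exists a, b, c, d.
  case: (posnP d) => [d0|d_gt0]; last by exists a, b, d, c; split=> //; lia.
  by case: (not2 a b); rewrite e c0 d0; lia.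
- case: (posnP c) => [c0|c_gt0]; first by case: (not2 a d); rewrite e b0 c0; lia.
  case: (posnP d) => [d0|d_gt0]; first by case: (not2 a c); rewrite e b0 d0; lia.
  by exists a, c, d, b; split=> //; lia.
- case: (posnP b) => [b0|b_gt0]; first by case: (not2 c d); rewrite e a0 b0; lia.
  case: (posnP c) => [c0|c_gt0]; first by case: (not2 b d); rewrite e a0 c0; lia.
  case: (posnP d) => [d0|d_gt0]; first by case: (not2 b c); rewrite e a0 d0; lia.
  by exists b, c, d, a; split=> //; lia.
Qed.

(** The classes 3 mod 4 and 6 mod 8, together with four times these classes. *)
Definition good_residue (m : nat) : bool :=
  [|| m %% 4 == 3, m %% 8 == 6, m %% 16 == 12 | m %% 32 == 24].

Lemma good_residue_squares (m : nat) : good_residue m ->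
  exists a b c d : nat, [/\ 0 < a, 0 < b, 0 < c & m = a ^ 2 + b ^ 2 + c ^ 2 + d ^ 2].
Proof.
rewrite /good_residue => hm.
have [h|h] : (m %% 4 == 3) || (m %% 8 == 6) \/ (m = 4 * (m %/ 4)) /\
  ((m %/ 4 %% 4 == 3) || (m %/ 4 %% 8 == 6)) by lia.
  exact: three_nonzero_squares.
case: h => em /three_nonzero_squares[a [b [c [d [a0 b0 c0 e]]]]].
exists (2 * a), (2 * b), (2 * c), (2 * d); rewrite em e !expnMn !muln_gt0 -!mulnDr.
by split.
Qed.

Lemma good_residue_mod32 (m m' : nat) : m = m' %[mod 32] -> good_residue m = good_residue m'.
Proof. by rewrite /good_residue; lia. Qed.

Lemma exists_shift (n : nat) : exists r : nat, [/\ 0 < r < 40, 5 %| r &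
  forall a, a ^ 2 = r ^ 2 %[mod 32] -> a ^ 2 <= n -> good_residue (n - a ^ 2)].
Proof.
(* A finite check mod 32; [1248 = 39 * 32] exceeds [35 ^ 2], so the subtraction is not truncated. *)
have /allP/(_ (n %% 32)) : all (fun v => has (fun r => good_residue (v + 1248 - r ^ 2))
  [:: 5; 10; 15; 20; 25; 30; 35]) (iota 0 32) by [].
rewrite mem_iota ltn_mod => /(_ isT)/hasP[r rin hr]; exists r.
have r_lt : 0 < r < 40 by move: rin; rewrite !inE; lia.
split=> //; first by move: rin; rewrite !inE; lia.
move=> a ea le_an; rewrite (_ : good_residue _ = good_residue (n %% 32 + 1248 - r ^ 2)) //.
have : r ^ 2 <= 1248 by rewrite (@leq_trans (35 ^ 2)) // leq_exp2r //; move: rin; rewrite !inE; lia.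
by move=> hr2; apply: good_residue_mod32; lia.
Qed.

Lemma sort_reps (n : nat) (l : seq nat) : all (leq 1) l ->
  sumn [seq x ^ 2 | x <- l] = n -> sort geq l \in reps (size l) n n.
Proof.
move=> l_gt0 <-; set n0 := sumn _.
have geq_total : total geq by move=> x y; apply: leq_total.
have le_n : all (geq n0) l.
  rewrite /n0; elim: (l) => //= x t IH; apply/andP; split.
    by apply: leq_trans (leq_addr _ _); case: (x) => // k; rewrite -mulnn leq_pmull.
  by apply: sub_all IH => y /= le_y; apply: leq_trans le_y (leq_addl _ _).
rewrite mem_reps size_sort eqxx all_sort l_gt0 /= path_min_sorted ?all_sort //.
rewrite sort_sorted //= !sumnE -/n0 /n0 sumnE !big_map.
by apply/eqP/perm_big; rewrite perm_sort.
Qed.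

(* With a = 5 k, a vanishing fourth square is avoided by a ^ 2 = (3 k) ^ 2 + (4 k) ^ 2. *)
Lemma five_squares (n r i : nat) (a := 40 * i + (if odd i then 40 - r else r)) :
  0 < r < 40 -> 5 %| r -> a ^ 2 <= n -> good_residue (n - a ^ 2) ->
  exists2 t, t \in reps 5 n n & (a \in t) || (a %/ 5 * 4 \in t).
Proof.
move=> r_bd r5 le_an /good_residue_squares[x [y [z [w [x0 y0 z0 e]]]]].
have a_gt0 : 0 < a by rewrite /a; case: ifP; lia.
have [w0|w_gt0] := posnP w.
  have [k ek] : exists k, a = k * 5 by apply/dvdnP; rewrite /a; case: ifP; lia.
  have k_gt0 : 0 < k by lia.
  exists (sort geq [:: k * 3; k * 4; x; y; z]).
    apply: (@sort_reps _ [:: k * 3; k * 4; x; y; z]); first by rewrite /= x0 y0 z0; lia.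
    move: e le_an; rewrite w0 ek /= !expnMn; clear; lia.
  by rewrite ek mulnK // !mem_sort !inE eqxx !orbT.
exists (sort geq [:: a; x; y; z; w]); last by rewrite mem_sort mem_head.
apply: (@sort_reps _ [:: a; x; y; z; w]); first by rewrite /= a_gt0 x0 y0 z0 w_gt0.
by move: e le_an; rewrite /=; clear; lia.
Qed.

(* A partition is hit by at most 10 values of i, since i = a %/ 40 where a or
   4 a / 5 is one of its 5 parts. *)
Lemma p2_5_sqrt (n K : nat) : (40 * K) ^ 2 <= n -> K <= 10 * p2 n 5.
Proof.
move=> hn; have [r [r_bd r5 hr]] := exists_shift n.
pose g (t : seq nat) := [seq x %/ 40 | x <- t] ++ [seq x %/ 4 * 5 %/ 40 | x <- t].
rewrite (p2E 5 (ltn_succ_sqr n)).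
have -> : 10 * size (reps 5 n n) = size (flatten [seq g t | t <- reps 5 n n]).
  rewrite size_flatten /shape -map_comp.
  have /eq_in_map-> : {in reps 5 n n, size \o g =1 fun=> 10}.
    move=> t; rewrite mem_reps => /and4P[/eqP st _ _ _].
    by rewrite /= size_cat !size_map st.
  by elim: (reps 5 n n) => //= t l IH; rewrite mulnS IH.
rewrite -{1}(size_iota 0 K); apply: uniq_leq_size; first exact: iota_uniq.
move=> i; rewrite mem_iota => /andP[_ ltiK].
(* [a] is [r] or [- r] mod 80, so one of [a - r], [a + r] is divisible by 16 and the other is even;
   each block of 40 integers contains one such [a]. *)
pose a := 40 * i + (if odd i then 40 - r else r).
have ai : a %/ 40 = i by rewrite /a; case: ifP; lia.
have a5 : a %/ 5 * 5 = a by rewrite /a; case: ifP; lia.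
have le_an : a ^ 2 <= n by apply: leq_trans hn; rewrite leq_exp2r // /a; case: ifP; lia.
have ea : a ^ 2 = r ^ 2 %[mod 32].
  have le_ra : r <= a by rewrite /a; case: ifP; lia.
  apply/eqP; rewrite eqn_mod_dvd ?leq_exp2r // subn_sqr.
  have [h1 h2] : 2 %| a - r /\ 2 %| a + r by rewrite /a; case: ifP; lia.
  have [h|h] : 16 %| a - r \/ 16 %| a + r by rewrite /a; case: ifP; lia.
    exact: (@dvdn_mul 16 2).
  exact: (@dvdn_mul 2 16).
have [t tin ht] := five_squares r_bd r5 le_an (hr _ ea le_an).
apply/flatten_mapP; exists t => //; rewrite mem_cat.
case/orP: ht => at_; apply/orP; [left|right]; apply/mapP.
  by exists a.
by exists (a %/ 5 * 4) => //; rewrite mulnK // a5.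
Qed.

Theorem theorem6p3 (m : nat) (hm : m \in [:: 259; 304; 308; 372; 394; 483; 497]) :
  ~ (exists n : nat, 0 < n /\ p2 n 5 = m).
Proof.
case=> n [_ e].
have m_lt : m < 498 by move: hm; rewrite !inE; lia.
have [n1|n1] := leqP n (N.to_nat 26000).
  by have := p2_5_avoids n1; rewrite e hm.
have [n2|n2] := leqP n (N.to_nat 40000000000).
  by have := @p2_5_large n; rewrite e; lia.
(* [4971 > 10 * 497] gives at least 498 partitions, and [40 * 4971] is below [200000], the square
   root of the bound on [n]. *)
have := @p2_5_sqrt n (N.to_nat 4971); rewrite e; lia.
Qed.
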